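(* The set consisting of the two clauses $$x\approx\neg x\Rightarrow\emptyset\qquad\text{and}\qquad \neg x\preccurlyeq x,\ x\wedge\neg y\preccurlyeq\neg x\vee y\ \Rightarrow\ \neg y\preccurlyeq y$$ is a basis for the admissible clauses of Kleene lattices, and the set consisting of the single quasi-identity $$\neg x\preccurlyeq x,\ x\wedge\neg y\preccurlyeq\neg x\vee y\ \Rightarrow\ \neg y\preccurlyeq y$$ is a basis for the admissible quasi-identities of Kleene lattices.
   Context: A Kleene lattice is an algebra $(A,\wedge,\vee,\neg)$ such that $(A,\wedge,\vee)$ is a distributive lattice, $\neg\neg a=a$, $\neg(a\wedge b)=\neg a\vee\neg b$, and $a\wedge\neg a\leq b\vee\neg b$ for all $a,b\in A$ (no constants for bounds in the language). All algebras are non-empty. $\varphi\preccurlyeq\psi$ abbreviates the identity $\varphi\wedge\psi\approx\varphi$. A clause $\Sigma\Rightarrow\Delta$ (with $\Sigma,\Delta$ finite, possibly empty, sets of identities) is satisfied by an algebra if every assignment of the variables making all identities in $\Sigma$ true makes at least one identity in $\Delta$ true (so $\Sigma\Rightarrow\emptyset$ means that no assignment makes all of $\Sigma$ true). It is a quasi-identity if $|\Delta|=1$. A universal class (resp. quasivariety) is the class of all algebras of the language satisfying some set of clauses (resp. quasi-identities); $\mathbb{U}(\mathcal{K})$ and $\mathbb{Q}(\mathcal{K})$ are the smallest universal class and smallest quasivariety containing $\mathcal{K}$. For a quasivariety $\mathcal{Q}$, $\mathbf{F}_{\mathcal{Q}}$ is its free algebra on countably infinitely many generators. A set $\Lambda$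 of clauses (resp. quasi-identities) is a basis for the admissible clauses (resp. quasi-identities) of $\mathcal{Q}$ if for every algebra $\mathbf{A}$: $\mathbf{A}\in\mathbb{U}(\mathbf{F}_{\mathcal{Q}})$ (resp. $\mathbf{A}\in\mathbb{Q}(\mathbf{F}_{\mathcal{Q}})$) iff $\mathbf{A}\in\mathcal{Q}$ and $\mathbf{A}$ satisfies all members of $\Lambda$. *)

(* Defs.v *)
From HB Require Import structures.
From mathcomp Require Import all_boot.
From mathcomp Require Import finmap.
From mathcomp Require Import boolp classical_sets.

Set Implicit Arguments.
Unset Strict Implicit.
Unset Printing Implicit Defensive.

Local Open Scope fset_scope.
Local Open Scope classical_set_scope.
Local Open Scope quotient_scope.

Record algebra := Algebra {
  carrier :> Type;
  carrier_nonempty : inhabited carrier;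
  meet : carrier -> carrier -> carrier;
  join : carrier -> carrier -> carrier;
  neg : carrier -> carrier }.

Inductive term : Set :=
| Var of nat
| Meet of term & term
| Join of term & term
| Neg of term.

HB.instance Definition _ := gen_eqMixin term.
HB.instance Definition _ := gen_choiceMixin term.

Fixpoint eval (A : algebra) (v : nat -> A) (t : term) : A :=
  match t with
  | Var n => v n
  | Meet s u => meet (eval v s) (eval v u)
  | Join s u => join (eval v s) (eval v u)
  | Neg s => neg (eval v s)
  end.

Definition identity : Set := (term * term)%type.

Declare Scope identity_scope.
Delimit Scope identity_scope with ID.
Bind Scope identity_scope with term.
Notation "x '`/\' y" := (Meet x y)
  (at level 48, left associativity) : identity_scope.
Notation "x '`\/' y" := (Join x y)
  (at level 50, left associativity) : identity_scope.
Notation "'`~' x" := (Neg x) (at level 35, right associativity) : identity_scope.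
Notation "s '=~=' t" := (s%ID, t%ID)
  (at level 70, no associativity, only parsing) : identity_scope.
Notation "s '<~=' t" := (Meet s%ID t%ID, s%ID)
  (at level 70, no associativity, only parsing) : identity_scope.

Definition holds (A : algebra) (v : nat -> A) (e : identity) : Prop :=
  eval v e.1 = eval v e.2.

Record clause := Clause {
  premises : {fset identity};
  conclusions : {fset identity} }.

Definition satisfies (A : algebra) (c : clause) : Prop :=
  forall v : nat -> A,
    (forall e, e \in premises c -> holds v e) ->
    exists2 e, e \in conclusions c & holds v e.

Definition quasi_identity (c : clause) : Prop := #|` conclusions c| = 1.

(* Classes are bare predicates rather than elements of [set algebra]: the
   universe of [set] is below that of the carriers of [choiceType]s, hence too
   small for [algebra] if carriers are to include the quotient below. *)
Definition class := algebra -> Prop.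

Definition subclass (K L : class) : Prop := forall A, K A -> L A.

Definition models (Th : set clause) : class :=
  fun A => forall c, Th c -> satisfies A c.

Definition universal_class (K : class) : Prop :=
  exists Th : set clause, forall A, K A <-> models Th A.

Definition quasivariety (K : class) : Prop :=
  exists2 Th : set clause, Th `<=` quasi_identity &
    forall A, K A <-> models Th A.

Definition smallest_class (P : class -> Prop) (K : class) : class :=
  fun A => forall L : class, P L -> subclass K L -> L A.

Definition UU (K : class) : class := smallest_class universal_class K.

Definition QQ (K : class) : class := smallest_class quasivariety K.

Definition valid (K : class) (e : identity) : Prop :=
  forall A, K A -> forall v : nat -> A, holds v e.

Definition valid_rel (K : class) : rel term := fun s t => `[< valid K (s, t) >].

Lemma valid_rel_equiv (K : class) : equiv_class_of (valid_rel K).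
Proof.
split=> [s|s t|t s u]; first by apply/asboolP.
- by apply/asboolP/asboolP => st A KA v; rewrite /holds /= st.
- move=> /asboolP st /asboolP tu; apply/asboolP => A KA v.
  by rewrite /holds /= (st A KA v) -(tu A KA v).
Qed.

Canonical valid_equiv (K : class) : equiv_rel term :=
  EquivRelPack (valid_rel_equiv K).

Definition free_carrier (K : class) := {eq_quot (valid_equiv K)}.

(* When [K] is a quasivariety, this is its free algebra on countably many
   generators, namely the classes of the [Var n]; see [free_algebra_in] and
   [free_algebra_universal]. *)
Definition free_algebra (K : class) : algebra := {|
  carrier := free_carrier K;
  carrier_nonempty := inhabits (\pi_(free_carrier K) (Var 0));
  meet := fun a b => \pi_(free_carrier K) (Meet (repr a) (repr b));
  join := fun a b => \pi_(free_carrier K) (Join (repr a) (repr b));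
  neg := fun a => \pi_(free_carrier K) (Neg (repr a)) |}.

Definition homomorphism (A B : algebra) (f : A -> B) : Prop :=
  [/\ forall a b, f (meet a b) = meet (f a) (f b),
      forall a b, f (join a b) = join (f a) (f b) &
      forall a, f (neg a) = neg (f a)].

Lemma free_eqP (K : class) (s t : term) :
  \pi_(free_carrier K) s = \pi_(free_carrier K) t <-> valid K (s, t).
Proof.
split; first by move=> /eqmodP /asboolP.
by move=> st; apply/eqmodP/asboolP.
Qed.

Lemma valid_repr (K : class) (t : term) :
  valid K (repr (\pi_(free_carrier K) t), t).
Proof. by apply/free_eqP; rewrite reprK. Qed.

Fixpoint subst (r : nat -> term) (t : term) : term :=
  match t with
  | Var n => r n
  | Meet s u => Meet (subst r s) (subst r u)
  | Join s u => Join (subst r s) (subst r u)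
  | Neg s => Neg (subst r s)
  end.

Lemma eval_subst (A : algebra) (v : nat -> A) (r : nat -> term) (t : term) :
  eval v (subst r t) = eval (fun n => eval v (r n)) t.
Proof. by elim: t => //= [s -> u ->|s -> u ->|s ->]. Qed.

Lemma eval_free (K : class) (v : nat -> free_algebra K) (t : term) :
  eval v t = \pi_(free_carrier K) (subst (fun n => repr (v n)) t).
Proof.
elim: t => /= [n|s -> u ->|s -> u ->|s ->]; first by rewrite reprK.
- apply/free_eqP => A KA w; rewrite /holds /=.
  by have /= -> := valid_repr _ KA w; have /= -> := valid_repr _ KA w.
- apply/free_eqP => A KA w; rewrite /holds /=.
  by have /= -> := valid_repr _ KA w; have /= -> := valid_repr _ KA w.
- apply/free_eqP => A KA w; rewrite /holds /=.
  by have /= -> := valid_repr _ KA w.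
Qed.

Lemma free_algebra_in (K : class) : quasivariety K -> K (free_algebra K).
Proof.
move=> [Th Thqi KTh]; apply/KTh => c Thc v prem.
have /eqP/cardfs1P[e ce] := Thqi _ Thc.
exists e; first by rewrite ce inE.
rewrite /holds !eval_free; apply/free_eqP => A KA w.
rewrite /holds /= !eval_subst.
have /KTh/(_ c Thc) Ac := KA.
have [|e'] := Ac (fun n => eval w (repr (v n))).
  move=> e' /prem; rewrite /holds !eval_free => /free_eqP/(_ A KA w).
  by rewrite /holds /= !eval_subst.
by rewrite ce inE => /eqP ->.
Qed.

Lemma free_algebra_universal (K : class) (A : algebra) (v : nat -> A) : K A ->
  exists! f : free_algebra K -> A,
    homomorphism f /\ forall n, f (\pi_(free_carrier K) (Var n)) = v n.
Proof.
move=> KA; have rv t : eval v (repr (\pi_(free_carrier K) t)) = eval v t.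
  exact: valid_repr t _ KA v.
exists (fun a => eval v (repr a)); split.
  split; last by move=> n; rewrite rv.
  by split=> [a b|a b|a]; rewrite rv.
move=> f [[fm fj fn] fv]; apply/funext => a.
have ft t : f (\pi_(free_carrier K) t) = eval v t.
  have -> : \pi_(free_carrier K) t =
      eval (A := free_algebra K) (fun n => \pi_(free_carrier K) (Var n)) t.
    rewrite eval_free; apply/free_eqP => B KB w.
    rewrite /holds /= eval_subst; congr (eval _ t).
    by apply/funext => n; have /= -> := valid_repr _ KB w.
  elim: t => /= [n|s <- u <-|s <- u <-|s <-];
    [exact: fv|exact: fm|exact: fj|exact: fn].
by rewrite -ft reprK.
Qed.

Definition kleene_lattice : class := fun A =>
  [/\ [/\ associative (@meet A), commutative (@meet A),
          associative (@join A) & commutative (@join A)],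
      (forall a b : A, join a (meet a b) = a) /\
      (forall a b : A, meet a (join a b) = a),
      left_distributive (@meet A) (@join A),
      (forall a : A, neg (neg a) = a) /\
      (forall a b : A, neg (meet a b) = join (neg a) (neg b)) &
      forall a b : A,
        meet (meet a (neg a)) (join b (neg b)) = meet a (neg a)].

Lemma kleene_lattice_quasivariety : quasivariety kleene_lattice.
Proof.
pose x := Var 0; pose y := Var 1; pose z := Var 2.
pose E : seq identity := [::
  (x `/\ (y `/\ z) =~= x `/\ y `/\ z)%ID; (x `/\ y =~= y `/\ x)%ID;
  (x `\/ (y `\/ z) =~= x `\/ y `\/ z)%ID; (x `\/ y =~= y `\/ x)%ID;
  (x `\/ (x `/\ y) =~= x)%ID; (x `/\ (x `\/ y) =~= x)%ID;
  ((x `\/ y) `/\ z =~= (x `/\ z) `\/ (y `/\ z))%ID;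
  (`~ `~ x =~= x)%ID; (`~ (x `/\ y) =~= `~ x `\/ `~ y)%ID;
  (x `/\ `~ x <~= y `\/ `~ y)%ID].
exists [set c | exists2 e, e \in E & c = Clause fset0 [fset e]].
  by move=> _ [e _ ->]; rewrite /quasi_identity /= cardfs1.
have E_holds A : models [set c | exists2 e, e \in E & c = Clause fset0 [fset e]] A
    <-> forall e, e \in E -> forall v : nat -> A, holds v e.
  split=> [mA e eE v|AE _ [e eE ->] v _].
    have [|//|e'] := mA (Clause fset0 [fset e]) _ v; first by exists e.
    by rewrite inE => /eqP ->.
  by exists e; [rewrite /= inE | exact: AE].
move=> A; rewrite E_holds; split.
  move=> [[mA mC jA jC] [jm mj] D [nn dm] kl] e.
  rewrite !inE => eE v; move: eE; do 9?[case/orP]; move=> /eqP ->;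
    rewrite /holds /=; by [exact: mA|exact: mC|exact: jA|exact: jC|
    exact: jm|exact: mj|exact: D|exact: nn|exact: dm|exact: kl].
move=> AE.
pose v (a b c : A) n := match n with 0 => a | 1 => b | _ => c end.
have H i : i < size E -> forall a b c, holds (v a b c) (nth (x, x) E i).
  by move=> iE a b c; apply/AE/mem_nth.
split; [split|split| |split|].
- by move=> a b c; exact: (H 0 isT a b c).
- by move=> a b; exact: (H 1 isT a b a).
- by move=> a b c; exact: (H 2 isT a b c).
- by move=> a b; exact: (H 3 isT a b a).
- by move=> a b; exact: (H 4 isT a b a).
- by move=> a b; exact: (H 5 isT a b a).
- by move=> a b c; exact: (H 6 isT a b c).
- by move=> a; exact: (H 7 isT a a a).
- by move=> a b; exact: (H 8 isT a b a).
- by move=> a b; exact: (H 9 isT a b a).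
Qed.

Definition admissible_clause_basis (K : class) (L : set clause) : Prop :=
  forall A, UU (eq (free_algebra K)) A <-> K A /\ models L A.

Definition admissible_quasi_identity_basis (K : class) (L : set clause) : Prop :=
  L `<=` quasi_identity /\
  forall A, QQ (eq (free_algebra K)) A <-> K A /\ models L A.

Definition no_fixpoint_clause : clause :=
  let x := Var 0 in
  Clause [fset (x =~= `~ x)%ID] fset0.

Definition kleene_quasi_identity : clause :=
  let x := Var 0 in let y := Var 1 in
  Clause [fset (`~ x <~= x)%ID; (x `/\ `~ y <~= `~ x `\/ y)%ID]
         [fset (`~ y <~= y)%ID].

(* Main.v *)
(* Every Kleene lattice A is separated by homomorphisms into the three-element
   Kleene chain (prime filters), so the free algebra F can be tested by
   evaluating terms in that chain. If A satisfies the quasi-identity, every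
   nonzero homomorphism h : A -> three is refined by a two-valued one w: take a
   prime filter containing [h = 1] and all x with ~x <= x, and avoiding all x
   with x <= ~x; the quasi-identity says exactly that these do not clash.
   Given an assignment v in A falsifying finitely many identities e_i, choose
   such pairs (h_i, w_i) with h_i separating the two sides of e_i. Fresh
   variables z select among the pairs, and terms T_j are built whose value under
   any p : nat -> three is g (v j) with g one of h_i, w_i or the constant
   middle homomorphism, each h_i being attained. The assignment j |-> T_j in F
   satisfies every identity satisfied by v and falsifies every e_i. *)
Require Import Defs.
From mathcomp Require Import all_boot.
From mathcomp Require Import finmap.
From mathcomp Require Import boolp classical_sets.

Set Implicit Arguments.
Unset Strict Implicit.
Unset Printing Implicit Defensive.

Local Open Scope classical_set_scope.

(** * The lattice order and De Morgan rules *)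

Definition le (A : algebra) (a b : A) : Prop := meet a b = a.

Lemma lexx (A : algebra) (kl : kleene_lattice A) (a : A) : le a a.
Proof.
have [_ [jm mj] _ _ _] := kl.
by rewrite /le -{2}(jm a a) mj.
Qed.

Lemma le_trans (A : algebra) (kl : kleene_lattice A) (b a c : A) :
  le a b -> le b c -> le a c.
Proof.
have [[mA _ _ _] _ _ _ _] := kl.
by rewrite /le => ab bc; rewrite -ab -mA bc.
Qed.

Lemma leIl (A : algebra) (kl : kleene_lattice A) (a b : A) : le (meet a b) a.
Proof.
have [[mA mC _ _] _ _ _ _] := kl.
by rewrite /le mC mA lexx.
Qed.

Lemma leIr (A : algebra) (kl : kleene_lattice A) (a b : A) : le (meet a b) b.
Proof. by have [[_ mC _ _] _ _ _ _] := kl; rewrite mC; apply: leIl. Qed.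

Lemma lexI (A : algebra) (kl : kleene_lattice A) (a b c : A) :
  le c a -> le c b -> le c (meet a b).
Proof.
have [[mA _ _ _] _ _ _ _] := kl.
by rewrite /le => ca cb; rewrite mA ca cb.
Qed.

Lemma leI2 (A : algebra) (kl : kleene_lattice A) (a b c d : A) :
  le a c -> le b d -> le (meet a b) (meet c d).
Proof.
move=> ac bd; apply: lexI => //.
  by apply: le_trans ac => //; apply: leIl.
by apply: le_trans bd => //; apply: leIr.
Qed.

Lemma leUl (A : algebra) (kl : kleene_lattice A) (a b : A) : le a (join a b).
Proof. by have [_ [_ mj] _ _ _] := kl; apply: mj. Qed.

Lemma leUr (A : algebra) (kl : kleene_lattice A) (a b : A) : le b (join a b).
Proof. by have [[_ _ _ jC] _ _ _ _] := kl; rewrite jC; apply: leUl. Qed.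

Lemma leUx (A : algebra) (kl : kleene_lattice A) (a b c : A) :
  le a c -> le b c -> le (join a b) c.
Proof.
have [_ _ mD _ _] := kl.
by rewrite /le mD => -> ->.
Qed.

Lemma leU2 (A : algebra) (kl : kleene_lattice A) (a b c d : A) :
  le a c -> le b d -> le (join a b) (join c d).
Proof.
move=> ac bd; apply: leUx => //.
  by apply: le_trans (leUl kl c d).
by apply: le_trans (leUr kl c d).
Qed.

Lemma negU (A : algebra) (kl : kleene_lattice A) (a b : A) :
  neg (join a b) = meet (neg a) (neg b).
Proof.
have [_ _ _ [nn nI] _] := kl.
by rewrite -[RHS]nn nI !nn.
Qed.

Lemma le_neg (A : algebra) (kl : kleene_lattice A) (a b : A) :
  le a b -> le (neg b) (neg a).
Proof.
have [_ _ _ [_ nI] _] := kl.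
by rewrite {1}/le => <-; rewrite nI; apply: leUr.
Qed.

Lemma kleene_le (A : algebra) (kl : kleene_lattice A) (a b : A) :
  le (meet a (neg a)) (join b (neg b)).
Proof. by have [_ _ _ _] := kl; apply. Qed.

(** * Prime filters and their separation theorem *)

Definition prime_filter (A : algebra) (W : set A) : Prop :=
  (forall a b, W (meet a b) <-> W a /\ W b) /\
  (forall a b, W (join a b) <-> W a \/ W b).

Lemma prime_filter_le (A : algebra) (W : set A) (a b : A) :
  prime_filter W -> le a b -> W a -> W b.
Proof. by move=> [WI _] <- /WI[]. Qed.

(** Zorn's lemma enlarges [J] to a maximal meet-closed set [W] with no element below one of [I];
    maximality makes it upward closed and prime. *)
Lemma prime_filter_separation (A : algebra) (kl : kleene_lattice A)
    (J I : set A) :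
    J !=set0 -> (forall a b, J a -> J b -> J (meet a b)) ->
    (forall a b, I a -> I b -> I (join a b)) ->
    (forall j i, J j -> I i -> ~ le j i) ->
  exists W : set A,
    [/\ prime_filter W, J `<=` W & forall i, I i -> ~ W i].
Proof.
move=> [j0 Jj0] JI IU JIdisj.
pose good (X : set A) := (forall a b, X a -> X b -> X (meet a b)) /\
  (forall j i, X j -> I i -> ~ le j i).
(* The condition is put on the union with [J], so that the empty chain, whose union is empty, is
   covered too. *)
have [C Cgood Ctot|M [[MI Mdisj] Mmax]] :=
    @Zorn_bigcup A [set X | good (X `|` J)].
  split=> [a b|j i [[X CX Xj]|Jj]]; last 2 first.
  - by have [_] := Cgood _ CX; apply; left.
  - exact: JIdisj.
  have CJ X : C X -> X `|` J `<=` (\bigcup_(X in C) X) `|` J.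
    by move=> CX c [Xc|]; [left; exists X|right].
  move=> [[X CX Xa]|Ja] [[Y CY Yb]|Jb]; last by right; apply: JI.
  - have [XY|YX] := Ctot _ _ CX CY.
      by apply: (CJ _ CY); apply: (Cgood _ CY).1; left => //; apply: XY.
    by apply: (CJ _ CX); apply: (Cgood _ CX).1; left => //; apply: YX.
  - by apply: (CJ _ CX); apply: (Cgood _ CX).1; [left|right].
  - by apply: (CJ _ CY); apply: (Cgood _ CY).1; [right|left].
pose W := M `|` J.
have Wmax Y : W `<=` Y -> good Y -> Y `<=` W.
  move=> WY gY c Yc; apply: contrapT => nWc.
  apply: (Mmax Y).
    split; last by move=> YM; apply: nWc; left; apply: YM.
    by move=> x Mx; apply: WY; left.
  rewrite /=; suff -> : Y `|` J = Y by [].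
  by apply/seteqP; split=> [x [//|Jx]|x]; [apply: WY; right|left].
have Wup a b : le a b -> W a -> W b.
  move=> ab Wa; apply: (Wmax [set y | exists2 m, W m & le m y]).
  - by move=> x Wx; exists x => //; apply: lexx.
  - split=> [x y [m Wm mx] [n Wn ny]|j i [m Wm mj] Ii ji].
      by exists (meet m n); [apply: MI|apply: leI2].
    by apply: (Mdisj m i) => //; apply: le_trans ji.
  - by exists a.
(* By maximality, the filter generated by [W] and a new element [a] must reach below [I]. *)
have Wadd a : ~ W a -> exists m i, [/\ W m, I i & le (meet m a) i].
  move=> nWa; apply: contrapT => no.
  apply: nWa; apply: (Wmax [set y | exists2 m, W m & le (meet m a) y]).
  - by move=> x Wx; exists x => //; apply: leIl.
  - split=> [x y [m Wm mx] [n Wn ny]|j i [m Wm mj] Ii ji].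
      exists (meet m n); first exact: MI.
      apply: lexI => //.
        by apply: le_trans mx => //; apply: leI2 => //; [exact: leIl|exact: lexx].
      by apply: le_trans ny => //; apply: leI2 => //; [exact: leIr|exact: lexx].
    by apply: no; exists m, i; split=> //; apply: le_trans ji.
  - by exists j0; [right|apply: leIr].
exists W; split; last 2 first.
- by move=> x Jx; right.
- by move=> i Ii Wi; apply: (Mdisj i i) => //; apply: lexx.
split=> a b; split.
- by move=> Wab; split; apply: Wup Wab; [apply: leIl|apply: leIr].
- by move=> []; apply: MI.
- move=> Wab; apply: contrapT => /not_orP[/Wadd[m [i [Wm Ii mai]]]].
  move=> /Wadd[n [k [Wn Ik nbk]]].
  apply: (Mdisj (meet (meet m n) (join a b)) (join i k)).
  + by apply: (MI) => //; apply: MI.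
  + exact: IU.
  + have [[_ mC _ _] _ mD _ _] := kl.
    rewrite mC mD; apply: leU2 => //; rewrite mC.
      by apply: le_trans mai => //; apply: leI2 => //; [exact: leIl|exact: lexx].
    by apply: le_trans nbk => //; apply: leI2 => //; [exact: leIr|exact: lexx].
- by move=> [] H; apply: Wup H; [apply: leUl|apply: leUr].
Qed.

(* The three-element Kleene chain [Some false < None < Some true]. *)
Definition meet3 (a b : option bool) : option bool :=
  match a, b with
  | Some false, _ | _, Some false => Some false
  | Some true, c | c, Some true => c
  | None, None => None
  end.

Definition neg3 : option bool -> option bool := omap negb.

Definition join3 (a b : option bool) : option bool :=
  neg3 (meet3 (neg3 a) (neg3 b)).

Definition three : algebra := {|
  carrier := option bool;
  carrier_nonempty := inhabits None;
  meet := meet3;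
  join := join3;
  neg := neg3 |}.

Lemma kleene_three : kleene_lattice three.
Proof.
split; [split|split| |split|]; rewrite /= /join3.
all: by do ?case=> [[]|].
Qed.

(** * Homomorphisms into the three-element chain *)

Lemma hom_eval (A B : algebra) (h : A -> B) (v : nat -> A) (t : term) :
  homomorphism h -> h (eval v t) = eval (fun n => h (v n)) t.
Proof.
by move=> [hI hU hN]; elim: t => //= [s <- u <-|s <- u <-|s <-].
Qed.

Lemma hom_negI (A B : algebra) (h : A -> B) :
  kleene_lattice A -> kleene_lattice B ->
  (forall a b, h (meet a b) = meet (h a) (h b)) ->
  (forall a, h (neg a) = neg (h a)) -> homomorphism h.
Proof.
move=> klA klB hI hN; split=> // a b.
have [_ _ _ [nnA _] _] := klA; have [_ _ _ [nnB _] _] := klB.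
by rewrite -[LHS]nnB -hN negU // hI !hN -negU // nnB.
Qed.

(** [None] alone is a subalgebra of [three], so this constant map is a homomorphism. *)
Definition zero_hom (A : algebra) (_ : A) : three := None.

Definition filter_hom (A : algebra) (W : set A) (a : A) : three :=
  match `[< W a >], `[< W (neg a) >] with
  | true, false => Some true
  | false, true => Some false
  | _, _ => None
  end.

(** The Kleene inequality keeps [W] from containing some [c] and [neg c] while missing some [d] and
    [neg d]. So the two cases sent to [None] never occur together. *)
Lemma filter_homP (A : algebra) (kl : kleene_lattice A) (W : set A) :
  prime_filter W -> homomorphism (filter_hom W).
Proof.
move=> pW; have [WI WU] := pW; have [_ _ _ [nn nI] _] := kl.
apply: hom_negI => //; first exact: kleene_three.
  move=> a b; rewrite /filter_hom nI.
  have -> : `[< W (meet a b) >] = `[< W a >] && `[< W b >].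
    by rewrite -asbool_and; apply: asbool_equiv_eq.
  have -> : `[< W (join (neg a) (neg b)) >] = `[< W (neg a) >] || `[< W (neg b) >].
    by rewrite -asbool_or; apply: asbool_equiv_eq.
  have K c d : `[< W c >] && `[< W (neg c) >] ==> `[< W d >] || `[< W (neg d) >].
    rewrite -asbool_and -asbool_or; apply/implyP => /asboolP Wc; apply/asboolP.
    by apply/WU; apply: (prime_filter_le pW (kleene_le kl c d)); apply/WI.
  move: (K a b) (K b a).
  by case: `[< W a >]; case: `[< W b >]; case: `[< W (neg a) >];
    case: `[< W (neg b) >].
by move=> a; rewrite /filter_hom nn; case: `[< W a >]; case: `[< W (neg a) >].
Qed.

Lemma hom_separation (A : algebra) (kl : kleene_lattice A) (a b : A) :
  a <> b -> exists2 h : A -> three, homomorphism h & h a <> h b.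
Proof.
suff sep c d : ~ le c d -> exists2 h : A -> three, homomorphism h & h c <> h d.
  move=> ab; have [ab'|] := pselect (le a b); last exact: sep.
  have [ba'|/sep[h hh /nesym hba]] := pselect (le b a); last by exists h.
  have [[_ mC _ _] _ _ _ _] := kl.
  by case: ab; rewrite -ab' mC.
move=> ncd.
have [|a' b' -> ->|a' b' -> ->|j i -> ->|W [pW Wc Wd]] :=
    prime_filter_separation kl (J := [set c]) (I := [set d]).
- by exists c.
- exact: lexx.
- by have [_ [jm _] _ _ _] := kl; rewrite /= -{2}(lexx kl d : meet d d = d) jm.
- exact: ncd.
exists (filter_hom W); first exact: filter_homP.
have {}Wc : W c by apply: Wc.
have {}Wd : ~ W d by apply: Wd.
rewrite /filter_hom (asboolT Wc) (asboolF Wd).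
case: asboolP => [nc|_]; case: asboolP => [//|nd] //.
(* Only the case of two values [None] is left: [W] contains [c] and [neg c] but neither [d] nor
   [neg d], against the Kleene inequality. *)
have [WI WU] := pW.
have /WU[//|//] : W (join d (neg d)).
by apply: (prime_filter_le pW (kleene_le kl c d)); apply/WI.
Qed.

Lemma valid_three (s t : term) :
  valid kleene_lattice (s, t) <-> forall p : nat -> three, holds p (s, t).
Proof.
split=> [st p|st A kl v]; first by apply: st; apply: kleene_three.
apply: contrapT => /(hom_separation kl)[h hh]; apply.
by rewrite !hom_eval //; apply: st.
Qed.

(** * Two-valued refinements of homomorphisms *)

(** The Kleene inequality gives [neg c <= c /\ neg c <= d \/ neg d <= d], so each negation lies
    below both elements. *)
Lemma neg_le_meet (A : algebra) (kl : kleene_lattice A) (a b : A) :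
  le (neg a) a -> le (neg b) b -> le (neg (meet a b)) (meet a b).
Proof.
have [_ _ _ [nn nI] _] := kl.
suff ab (c d : A) : le (neg c) c -> le (neg d) d -> le (neg c) d.
  by move=> na nb; rewrite nI; apply: leUx => //; apply: lexI => //; apply: ab.
move=> nc nd; apply: (le_trans kl (b := meet c (neg c))).
  by apply: lexI => //; apply: lexx.
apply: le_trans (kleene_le kl c d) _ => //.
by apply: leUx => //; apply: lexx.
Qed.

Lemma neg_le_joinN (A : algebra) (kl : kleene_lattice A) (a : A) :
  le (neg (join a (neg a))) (join a (neg a)).
Proof. by rewrite negU //; apply: (kleene_le kl (neg a) a). Qed.

Definition boolean (A : algebra) (w : A -> three) : Prop :=
  homomorphism w /\ forall a, w a <> None.

Lemma boolean_refinement (A : algebra) (kl : kleene_lattice A)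
    (h : A -> three) (a b : A) :
  satisfies A kleene_quasi_identity -> homomorphism h -> h a <> h b ->
  exists2 w : A -> three, boolean w & forall a, h a <> None -> w a = h a.
Proof.
move=> qi [hI hU hN] hab.
have [[mA mC _ jC] _ _ [nn nI] _] := kl.
have {}qi (x y : A) : le (neg x) x -> le (meet x (neg y)) (join (neg x) y) ->
    le (neg y) y.
  move=> nx xy; have [e|e] := qi (fun n => if n is 0 then x else y).
    by rewrite !inE => /orP[]/eqP ->.
  by rewrite inE => /eqP ->.
pose N (a : A) := le (neg a) a.
(* As [h] separates two elements, it is not constantly [None], hence takes the value [Some true] at
   some [p0]. This makes [J] nonempty and brings all of [N] into [W]. *)
have [c hc] : exists c, h c <> None.
  by case E: (h a) hab => [x|] hab; [exists a; rewrite E|exists b; apply/nesym].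
have [p0 hp0] : exists p, h p = Some true.
  case E: (h c) hc => [[]|] // _; first by exists c.
  by exists (neg c); rewrite hN E.
have [|x y [p hp [n Nn ->]] [q hq [m Nm ->]]|x y /= Ix Iy|
    j i [p hp [n Nn ->]] Ii pni|W [pW JW IW]] :=
  prime_filter_separation kl
    (J := [set a | exists2 p, h p = Some true & exists2 n, N n & a = meet p n])
    (I := [set a | le a (neg a)]).
- exists (meet p0 (join p0 (neg p0))); exists p0 => //.
  by exists (join p0 (neg p0)) => //; apply: neg_le_joinN.
- exists (meet p q); first by rewrite hI hp hq.
  exists (meet n m); first exact: neg_le_meet.
  by rewrite -!mA; congr meet; rewrite mA (mC n q) -mA.
- rewrite /= negU // -[X in le X _]nn negU //.
  by apply: neg_le_meet; rewrite // nn.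
(* From [p /\ n <= i <= neg i] follows [p /\ n <= neg (p /\ n)], the second premise for [x := n],
   [y := neg p]. The conclusion [p <= neg p] contradicts [h p = Some true]. *)
- suff /(congr1 h) : le (neg (neg p)) (neg p) by rewrite nn hI hN hp.
  apply: (qi n) => //; rewrite nn mC jC -nI; apply: (le_trans kl pni).
  by apply: (le_trans kl Ii); apply: le_neg.
have Wp p n : h p = Some true -> N n -> W (meet p n).
  by move=> hp Nn; apply: JW; exists p => //; exists n.
have [WI WU] := pW.
(* [W] contains [x \/ neg x], which is in [N], and avoids [x /\ neg x], which is in [I]; so it
   contains exactly one of [x] and [neg x]. *)
have W1 x : W x \/ W (neg x).
  by apply/WU; have /WI[] := Wp p0 _ hp0 (neg_le_joinN kl x).
have W0 x : ~ (W x /\ W (neg x)).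
  by move/WI; apply: IW; rewrite /= nI; apply: kleene_le.
have Wh x : h x = Some true -> W x.
  by move=> hx; have /WI[] := Wp x _ hx (neg_le_joinN kl x).
have wE x : filter_hom W x = Some `[< W x >].
  rewrite /filter_hom; case: asboolP => Wx; case: asboolP => Wnx //.
    by case: (W0 x).
  by case: (W1 x).
exists (filter_hom W); first by split=> [|x]; [apply: filter_homP|rewrite wE].
move=> x; case E: (h x) => [[]|] // _; rewrite wE.
  by rewrite asboolT //; apply: Wh.
rewrite asboolF // => Wx; apply: (W0 x); split=> //.
by apply: Wh; rewrite hN E.
Qed.

(** * Terms realizing homomorphisms pointwise *)

(** A case distinction on [z]; the guard [c] is [None] where [z] is, and absorption then makes the
    whole term [None]. *)
Definition select (z s t : term) : term :=
  let c := Join z (Neg z) in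
  Join (Meet c (Join (Meet z s) (Meet (Neg z) t))) (Neg c).

Lemma eval_select (p : nat -> three) (z s t : term) :
  eval p (select z s t) =
  match eval p z with
  | Some b => if b then eval p s else eval p t
  | None => None
  end.
Proof.
by rewrite /= /join3; case: (eval p z) => [[]|]; case: (eval p s) => [[]|];
  case: (eval p t) => [[]|].
Qed.

(** The language has no constants; these terms imitate them wherever [z] is classical. *)
Definition constant_term (z : term) (b : bool) : term :=
  if b then Join z (Neg z) else Meet z (Neg z).

Lemma eval_constant_term (p : nat -> three) (z : term) (b : bool) :
  eval p (constant_term z b) = if eval p z is Some _ then Some b else None.
Proof. by case: b => /=; rewrite /join3; case: (eval p z) => [[]|]. Qed.

(* At classical [z], takes the value [a] when [u] is [None] and [b], a refinement
   of [a], otherwise. *)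
Definition pattern_term (z u : term) (a b : three) : term :=
  match a, b with
  | Some c, _ => constant_term z c
  | None, Some c => constant_term u c
  | None, None => u
  end.

Lemma eval_pattern_term (p : nat -> three) (z u : term) (a b : three) :
  b <> None -> (a <> None -> b = a) -> eval p z <> None ->
  eval p (pattern_term z u a b) = if eval p u is None then a else b.
Proof.
case: b => // b _; case: a => [a|] /= ab; rewrite eval_constant_term //.
by rewrite ab //; case: (eval p z) => // ? _; case: (eval p u).
Qed.

(* [T] assigns to each variable a term whose value at each point [p] of the dual
   space of the free algebra is dictated by a homomorphism [A -> three]. *)
Definition realizes (A : algebra) (v : nat -> A) (T : nat -> term) : Prop :=
  forall p : nat -> three, exists2 g : A -> three, homomorphism g &
    forall j, eval p (T j) = g (v j).

(** Start of the construction: one variable suffices, giving [w] where it is classical and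
    [zero_hom] where it is [None]. *)
Lemma realizes_boolean (A : algebra) (v : nat -> A) (w : A -> three) :
  boolean w -> exists T, realizes v T.
Proof.
move=> [hw wb].
exists (fun j => constant_term (Var 0) (w (v j) == Some true)) => p.
case E: (p 0) => [b|].
  exists w => // j; rewrite eval_constant_term /= E.
  by have := wb (v j); case: (w (v j)) => [[]|].
by exists (@zero_hom A) => // j; rewrite eval_constant_term /= E.
Qed.

(* [Var 0] selects between [h] or [w], according to [Var 1], and the shifted [T];
   when [Var 0] is [None] the result is the constant [zero_hom]. *)
Lemma realizes_select (A : algebra) (v : nat -> A) (T : nat -> term)
    (h w : A -> three) :
  homomorphism h -> boolean w -> (forall a, h a <> None -> w a = h a) ->
  realizes v T ->
  exists T', [/\ realizes v T',
    forall p, exists p', forall j, eval p' (T' j) = eval p (T j) :> three &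
    exists p', forall j, eval p' (T' j) = h (v j)].
Proof.
move=> hh [hw wb] wh rT.
(* Terms are two-valued at two-valued points, so a value [None] of [h] needs a variable that is
   [None]; where [Var 1] is classical, [w] replaces [h]. The shift by two keeps both selectors
   fresh. *)
pose T' j := select (Var 0) (pattern_term (Var 0) (Var 1) (h (v j)) (w (v j)))
  (subst (fun n => Var n.+2) (T j)).
have T'E (p : nat -> three) j : eval p (T' j) =
    match p 0 with
    | Some b => if b then if p 1 is None then h (v j) else w (v j)
                else eval (fun n => p n.+2) (T j)
    | None => None
    end.
  rewrite eval_select eval_subst /=; case E: (p 0) => [[]|] //.
  by rewrite eval_pattern_term; [|exact: wb|exact: wh|rewrite /= E].
exists T'; split=> [p|p|].
- have [g hg gE] := rT (fun n => p n.+2).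
  case E0: (p 0) => [[]|]; last by exists (@zero_hom A) => // j; rewrite T'E E0.
    case E1: (p 1) => [b|]; first by exists w => // j; rewrite T'E E0 E1.
    by exists h => // j; rewrite T'E E0 E1.
  by exists g => // j; rewrite T'E E0 gE.
- exists (fun n => if n is m.+2 then p m else Some false) => j.
  by rewrite T'E.
- by exists (fun n => if n is 0 then Some true else None) => j; rewrite T'E.
Qed.

(** Induction on [s]: each new identity adds a separating [h] to the attained values, while the
    points refuting earlier identities keep copies. *)
Lemma realizes_separating (A : algebra) (kl : kleene_lattice A) (v : nat -> A)
    (w : A -> three) (s : seq identity) :
  satisfies A kleene_quasi_identity -> boolean w ->
  (forall e, e \in s -> ~ holds v e) ->
  exists2 T, realizes v T & forall e, e \in s ->
    exists p : nat -> three, ~ holds (fun j => eval p (T j)) e.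
Proof.
move=> qi bw; elim: s => [|e s IH] ns.
  by have [T rT] := realizes_boolean v bw; exists T.
have [|T rT sT] := IH; first by move=> f fs; apply: ns; rewrite inE fs orbT.
have /(hom_separation kl)[h hh hne] : ~ holds v e.
  by apply: ns; rewrite inE eqxx.
have [w' bw' w'h] := boolean_refinement kl qi hh hne.
have [T' [rT' TT' [p hp]]] := realizes_select hh bw' w'h rT.
exists T' => // f; rewrite inE => /orP[/eqP ->|/sT[q nq]].
  exists p; rewrite /holds (_ : (fun j => _) = (fun j => h (v j))).
    by rewrite -!hom_eval.
  by apply/funext.
have [q' qq'] := TT' q; exists q'.
by rewrite (_ : (fun j => _) = (fun j => eval q (T j))) //; apply/funext.
Qed.

(** * Transfer between the free algebra and a Kleene lattice *)

Lemma free_holdsP (v : nat -> free_algebra kleene_lattice) (e : identity) :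
  holds v e <->
  forall p : nat -> three, holds (fun n => eval p (repr (v n))) e.
Proof.
rewrite /holds !eval_free free_eqP valid_three.
by split=> H p; have := H p; rewrite /holds /= !eval_subst.
Qed.

Lemma free_holds_substP (T : nat -> term) (e : identity) :
  holds (fun n => \pi_(free_carrier kleene_lattice)%qT (T n)
           : free_algebra kleene_lattice) e <->
  forall p : nat -> three, holds (fun n => eval p (T n)) e.
Proof.
rewrite free_holdsP.
have E (p : nat -> three) :
    (fun n => eval p (repr (\pi_(free_carrier kleene_lattice)%qT (T n)))) =
    (fun n => eval p (T n)).
  by apply/funext => n; apply: (valid_repr _ kleene_three).
by split=> H p; have := H p; rewrite E.
Qed.

Lemma admissible_satisfied (A : algebra) (c : clause) :
  kleene_lattice A -> satisfies A kleene_quasi_identity ->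
  satisfies (free_algebra kleene_lattice) c ->
  satisfies A no_fixpoint_clause \/ quasi_identity c -> satisfies A c.
Proof.
move=> kl qi Fc nofix v prem; apply: contrapT => noc.
have {}noc e : e \in conclusions c -> ~ holds v e.
  by move=> ec ev; apply: noc; exists e.
(* Nontriviality of [A] yields the two-valued [w] that starts the construction, even when the clause
   has no conclusions. A quasi-identity refuted by [v] supplies two distinct elements itself. *)
have [a [b ab]] : exists a b : A, a <> b.
  case: nofix => [nofix|/eqP/cardfs1P[e ce]].
    have [a] := carrier_nonempty A.
    exists a, (neg a) => fa; have [|e] := nofix (fun=> a); last by rewrite inE.
    by move=> e; rewrite inE => /eqP ->.
  by exists (eval v e.1), (eval v e.2); apply: noc; rewrite ce inE.
have [h hh hab] := hom_separation kl ab.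
have [w bw _] := boolean_refinement kl qi hh hab.
have [T rT sT] := realizes_separating kl qi bw noc.
have [e ep|e ec /free_holds_substP eT] :=
    Fc (fun n => \pi_(free_carrier kleene_lattice)%qT (T n)).
  apply/free_holds_substP => p; have [g hg gE] := rT p.
  by rewrite (funext gE) /holds -!hom_eval //; congr g; apply: prem.
by have [p] := sT e ec; apply.
Qed.

(** * The two clauses hold in the free algebra *)

Lemma eval_boolean (p : nat -> three) (t : term) :
  (forall n, p n <> None) -> eval p t <> None.
Proof.
move=> pb; elim: t => //= [s + t|s + t|s]; rewrite /join3.
- by case: (eval p s) => [[]|]; case: (eval p t) => [[]|].
- by case: (eval p s) => [[]|]; case: (eval p t) => [[]|].
- by case: (eval p s) => [[]|].
Qed.

(** The operations of [three] are monotone in the information order, where [None] lies below both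
    classical values. *)
Lemma eval_refinement (p q : nat -> three) (t : term) :
  (forall n, p n <> None -> q n = p n) -> eval p t <> None ->
  eval q t = eval p t.
Proof.
move=> pq; elim: t => [n|s + t|s + t|s] /=; first exact: pq.
- case: (eval p s) => [[]|]; case: (eval p t) => [[]|] //= Hs Ht _;
    do ?[rewrite Hs; last by []]; do ?[rewrite Ht; last by []] => //;
    by case: (eval q s) => [[]|].
- rewrite /join3.
  case: (eval p s) => [[]|]; case: (eval p t) => [[]|] //= Hs Ht _;
    do ?[rewrite Hs; last by []]; do ?[rewrite Ht; last by []] => //;
    by case: (eval q s) => [[]|].
- by case: (eval p s) => [b|] //= ->.
Qed.

(** At a two-valued point a term and its negation take different values. *)
Lemma free_no_fixpoint :
  satisfies (free_algebra kleene_lattice) no_fixpoint_clause.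
Proof.
move=> v /(_ (Var 0, Neg (Var 0))).
rewrite inE eqxx => /(_ isT)/free_holdsP/(_ (fun=> Some true)).
have := @eval_boolean (fun=> Some true) (repr (v 0)) (fun=> ltac:(done)).
by rewrite /holds /=; case: (eval _ _) => [[]|] // /(_ erefl).
Qed.

Lemma free_kleene_quasi_identity :
  satisfies (free_algebra kleene_lattice) kleene_quasi_identity.
Proof.
move=> v prem; eexists; first by rewrite inE; apply/eqP.
have /free_holdsP nx := prem (`~ (Var 0) <~= Var 0)%ID (fset21 _ _).
have /free_holdsP xy :=
  prem (Var 0 `/\ `~ (Var 1) <~= `~ (Var 0) `\/ Var 1)%ID (fset22 _ _).
apply/free_holdsP => p.
(* Premises at [p] force the value of x to be [None] if that of y is [Some false];
   the two-valued refinement [q] then contradicts them. *)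
pose q n : three := if p n is Some b then Some b else Some true.
have qb n : q n <> None by rewrite /q; case: (p n).
have pq n : p n <> None -> q n = p n by rewrite /q; case: (p n).
move: (nx q) (xy q); rewrite /holds /= /join3.
have := @eval_boolean q (repr (v 0)) qb.
have := @eval_refinement p q (repr (v 1)) pq.
case: (eval p _) => [[]|] //= -> //.
by case: (eval q _) => [[]|].
Qed.

(** * The two bases *)

Theorem theorem40 :
  admissible_clause_basis kleene_lattice
    [set no_fixpoint_clause; kleene_quasi_identity] /\
  admissible_quasi_identity_basis kleene_lattice
    [set kleene_quasi_identity].
Proof.
have [Th Thqi KTh] := kleene_lattice_quasivariety.
have kF := free_algebra_in kleene_lattice_quasivariety.
have Fnf := free_no_fixpoint; have Fqi := free_kleene_quasi_identity.
have axioms Q A : kleene_lattice A /\ models Q A <-> models (Th `|` Q) A.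
  rewrite KTh; split=> [[mT mQ] c [/mT|/mQ]//|m].
  by split=> c cT; apply: m; [left|right].
have qq : quasi_identity kleene_quasi_identity by rewrite /quasi_identity cardfs1.
split; last split.
(* The Kleene lattices satisfying both clauses form a universal class containing the free algebra.
   Conversely, clauses defining any universal class around the free algebra hold in it, hence in
   [A]. *)
- move=> A; split=> [UA|[kA mA] L [S LS] /(_ _ erefl)/LS SF].
    apply: (UA (fun B => kleene_lattice B /\
      models [set no_fixpoint_clause; kleene_quasi_identity] B)).
      by eexists; exact: axioms.
    by move=> _ <-; split=> // c [->|->].
  apply/LS => c Sc; apply: admissible_satisfied => //.
  + by apply: mA; right.
  + exact: SF.
  + by left; apply: mA; left.
- by move=> c ->.
- move=> A; split=> [QA|[kA mA] L [S Sqi LS] /(_ _ erefl)/LS SF].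
    apply: (QA (fun B => kleene_lattice B /\ models [set kleene_quasi_identity] B)).
      exists (Th `|` [set kleene_quasi_identity]); last exact: axioms.
      by move=> c [/Thqi|->].
    by move=> _ <-; split=> // c ->.
  apply/LS => c Sc; apply: admissible_satisfied => //.
  + exact: mA.
  + exact: SF.
  + by right; exact: Sqi.
Qed.
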